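(* Let $d\ge 1$. For each $\mu=(\mu_0,\ldots,\mu_{2d-1})\in\mathbb{R}^{2d}$ and for each $q=0,\ldots,2d-1$, the Prony variety $S_q(\mu)$ is a smooth submanifold of $\mathcal{P}_d$ (for $q\ge d$, possibly empty), and its node projection $S_q^x(\mu)$ is a smooth submanifold of $\mathcal{P}^x_d$.
   Context: Let $\mathcal{P}^x_d=\{(x_1,\ldots,x_d)\in\mathbb{R}^d : x_1<x_2<\cdots<x_d\}$ (the space of nodes), $\mathcal{P}^a_d=\mathbb{R}^d$ (the space of amplitudes $a=(a_1,\ldots,a_d)$), and $\mathcal{P}_d=\mathcal{P}^a_d\times\mathcal{P}^x_d$, an open subset of $\mathbb{R}^{2d}$. For $\mu=(\mu_0,\ldots,\mu_{2d-1})\in\mathbb{R}^{2d}$ and $0\le q\le 2d-1$, the Prony variety is $$S_q(\mu)=\Big\{(a,x)\in\mathcal{P}_d : \sum_{j=1}^d a_jx_j^k=\mu_k,\ k=0,1,\ldots,q\Big\}.$$ Its node projection is $S^x_q(\mu)=p_x(S_q(\mu))\subset\mathcal{P}^x_d$, where $p_x:\mathcal{P}_d\to\mathcal{P}^x_d$, $p_x(a,x)=x$. *)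

(* Defs.v *)
From HB Require Import structures.
From mathcomp Require Import all_boot all_order all_algebra.
From mathcomp Require Import all_classical all_reals all_analysis.

Set Implicit Arguments.
Unset Strict Implicit.
Unset Printing Implicit Defensive.

Import Order.TTheory GRing.Theory Num.Theory.
Import numFieldNormedType.Exports.

Local Open Scope classical_set_scope.
Local Open Scope ring_scope.

Section Smooth.
Context {R : realType}.

(* f is of class C^k on U.  Functions are total, but for U open only the values
   of f on U matter. *)
Fixpoint class_C (n p k : nat) (U : set 'rV[R]_n)
    (f : 'rV[R]_n -> 'rV[R]_p) : Prop :=
  match k with
  | 0 => forall x, U x -> {for x, continuous f}
  | k'.+1 => (forall x, U x -> differentiable f x) /\
             (forall v : 'rV[R]_n, class_C k' U (fun x => 'D_v f x))
  end.

Definition smooth (n p : nat) (U : set 'rV[R]_n) (f : 'rV[R]_n -> 'rV[R]_p) : Prop :=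
  forall k : nat, class_C k U f.

(* h is a C^oo-diffeomorphism from the open set U onto the open set V. *)
Definition diffeomorphism (n : nat) (U V : set 'rV[R]_n)
    (h : 'rV[R]_n -> 'rV[R]_n) : Prop :=
  [/\ open U, open V, smooth U h, h @` U = V &
      exists g : 'rV[R]_n -> 'rV[R]_n, [/\ smooth V g & forall x, U x -> g (h x) = x]].

(* The subspace R^m x {0} of R^n. *)
Definition coord_slice (n m : nat) : set 'rV[R]_n :=
  [set y | forall i : 'I_n, (m <= i)%N -> y 0 i = 0].

(* S is an m-dimensional smooth (embedded) submanifold of the open set M of
   R^n: around each of its points, some chart of M straightens S to
   R^m x {0}.  The empty set qualifies for every m <= n. *)
Definition is_submanifold_dim (n m : nat) (M S : set 'rV[R]_n) : Prop :=
  [/\ (m <= n)%N, S `<=` M &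
      forall p, S p ->
        exists (U V : set 'rV[R]_n) (h : 'rV[R]_n -> 'rV[R]_n),
          [/\ U p, U `<=` M, diffeomorphism U V h &
              h @` (U `&` S) = V `&` coord_slice m]].

Definition is_submanifold (n : nat) (M S : set 'rV[R]_n) : Prop :=
  exists m : nat, is_submanifold_dim m M S.

End Smooth.

Section Prony.
Context {R : realType}.

Definition node_space (d : nat) : set 'rV[R]_d :=
  [set x | forall i j : 'I_d, (i < j)%N -> x 0 i < x 0 j].
Arguments node_space d _ : clear implicits.

(* A point (a, x) of R^(2d) is [row_mx a x : 'rV_(d + d)]. *)
Definition amplitudes (d : nat) (p : 'rV[R]_(d + d)) : 'rV[R]_d := lsubmx p.
Definition nodes (d : nat) (p : 'rV[R]_(d + d)) : 'rV[R]_d := rsubmx p.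

Definition prony_space (d : nat) : set 'rV[R]_(d + d) :=
  [set p | node_space d (nodes p)].
Arguments prony_space d _ : clear implicits.

(* In [^+], 0 ^+ 0 = 1, so the moment of order 0 is the sum of the
   amplitudes. *)
Definition prony_variety (d q : nat) (mu : 'rV[R]_(2 * d)) :
    set 'rV[R]_(d + d) :=
  [set p | prony_space d p /\
     forall k : 'I_(2 * d), (k <= q)%N ->
       \sum_(j < d) amplitudes p 0 j * nodes p 0 j ^+ k = mu 0 k].

Definition prony_nodes (d q : nat) (mu : 'rV[R]_(2 * d)) : set 'rV[R]_d :=
  @nodes d @` prony_variety q mu.

End Prony.

Arguments node_space {R} d _.
Arguments prony_space {R} d _.

(* Main.v *)
From HB Require Import structures.
Require Import Defs.
From mathcomp Require Import all_boot all_order all_algebra.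
From mathcomp Require Import perm fingroup zify ring lra.
From mathcomp Require polyrcf.
From mathcomp Require Import all_classical all_reals all_analysis.

(** The Prony variety becomes affine in well chosen global coordinates.

    For nodes x_1 < ... < x_d let Q = \prod_j (X - x_j) = X^d + \sum_i c_i X^i.
    The Vieta map x |-> c is a diffeomorphism from the space of nodes onto the
    open set of coefficient vectors of polynomials with d distinct real roots
    ([diffeomorphism_vieta]).  Since a = m V(x)^-1, where V(x) is the Vandermonde
    matrix of x and m = (m_0, ..., m_(d-1)) are the first d moments of (a, x),
    the map (a, x) |-> (c, m) is a diffeomorphism from the Prony space onto an
    open set as well ([diffeomorphism_prony_chart]).

    The moments m_k = \sum_j a_j x_j^k satisfy the recurrence
    m_(d+k) = - \sum_i c_i m_(k+i), because Q vanishes at every node.  By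
    induction the equations m_k = mu_k for k <= q are therefore equivalent to
    m_k = mu_k for k <= q, k < d, together with the Hankel equations
    \sum_i c_i mu_(k-d+i) = - mu_k for d <= k <= q ([moments_hankel]).  These
    are affine in (c, m).  The equations that involve c alone describe the
    projection to the nodes, the first d moments being prescribed freely through
    the amplitudes.  A set which a diffeomorphism takes to the trace of an affine
    subspace is a submanifold ([is_submanifold_affine_chart]): a linear change of
    coordinates, found by Gaussian elimination, makes the subspace a coordinate
    subspace.

    Smoothness of the inverse Vieta map, that is, of the ordered roots as
    functions of the coefficients, is proved directly.  Sign changes of Q around
    each x_j and the intermediate value theorem show that the image is open and
    the roots are continuous ([vieta_local_surj]); the identity
    [sorted_roots_diffE] then exhibits a derivative in the sense of
    Caratheodory, which is a rational function of the roots themselves, so that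
    every order of differentiability yields the next one
    ([scalar_class_C_sorted_roots]). *)

Set Implicit Arguments.
Unset Strict Implicit.
Unset Printing Implicit Defensive.

Import Order.TTheory GRing.Theory Num.Theory.
Import numFieldNormedType.Exports.

(** * Differentiability criteria *)

Section SmoothCalculus.
Local Open Scope classical_set_scope.
Local Open Scope ring_scope.
Context {R : realType}.

Lemma near_eq_differentiable (V W : normedModType R) (f g : V -> W) (x : V) :
  (\near x, f x = g x) -> differentiable f x -> differentiable g x.
Proof.
move=> fg fx.
have [dfc dff] := (diff_locallyP x f).1 fx.
have gE : g \o shift x = cst (g x) + 'd f x +o_ (0 : V) id.
  apply/eqaddoP => _/posnumP[eps].
  have H := (eqaddoP _ _ _ _).1 dff _ (gt0 eps).
  have fg0 : \forall y \near (0 : V), f (y + x) = g (y + x).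
    by move: fg; rewrite (near_shift 0)/= subr0.
  near=> y.
  have Hy : `|(f \o shift x - (cst (f x) + 'd f x)) y| <= eps%:num * `|y|.
    by near: y; exact: H.
  move: Hy; rewrite -(nbhs_singleton fg) !fctE/=.
  by have <- : f (y + x) = g (y + x) by near: y.
have dE := diff_unique dfc gE.
by apply/diff_locallyP; rewrite dE; split.
Unshelve. all: by end_near. Qed.

(** Caratheodory's criterion: a factorization of f y - f c through the
    coordinates of y - c, with coefficients that are merely continuous at c,
    makes f differentiable at c. *)
Lemma differentiable_caratheodory (n : nat) (f : 'rV[R]_n -> R)
    (A : 'I_n -> 'rV[R]_n -> R) (c : 'rV[R]_n) :
  (forall i, {for c, continuous (A i)}) ->
  (\forall y \near c, f y - f c = \sum_i (y 0 i - c 0 i) * A i y) ->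
  differentiable f c /\ forall v, 'D_v f c = \sum_i v 0 i * A i c.
Proof.
move=> Ac fA.
pose L : 'rV[R]_n -> R := fun v => \sum_i v 0 i * A i c.
have Llin : linear L.
  move=> k u v; rewrite /L scaler_sumr -big_split; apply: eq_bigr => i _ /=.
  by rewrite !mxE mulrDl -mulrA.
pose Ll : {linear 'rV[R]_n -> R} := HB.pack L (GRing.isLinear.Build _ _ _ _ L Llin).
have Lc : continuous Ll.
  apply: continuous_big => [|i _ v]; first exact: add_continuous.
  by apply: (@cvgM _ _ (nbhs v)); [exact: coord_continuous|exact: cvg_cst].
have fE : f \o shift c = cst (f c) + Ll +o_ (0 : 'rV[R]_n) id.
  apply/eqaddoP => _/posnumP[eps].
  (* The sum has n terms; n.+1 avoids a zero denominator when n = 0. *)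
  have e1 : 0 < eps%:num / n.+1%:R by rewrite divr_gt0.
  have An : \forall y \near (0 : 'rV[R]_n), forall i,
      `|A i (y + c) - A i c| <= eps%:num / n.+1%:R.
    apply: (@filter_forall _ _ _ (nbhs (0 : 'rV[R]_n))) => i.
    have H : \forall y \near c, `|A i y - A i c| <= eps%:num / n.+1%:R.
      have /cvgrPdist_le/(_ _ e1) := Ac i.
      by apply: filterS => y; rewrite distrC.
    by move: H; rewrite (near_shift 0)/= subr0.
  move: fA; rewrite (near_shift 0)/= subr0 => fA.
  near=> y.
  have -> : (f \o shift c - (cst (f c) + Ll)) y =
      \sum_i y 0 i * (A i (y + c) - A i c).
    rewrite !fctE /= opprD addrA.
    have -> : f (y + c) - f c = \sum_i ((y + c) 0 i - c 0 i) * A i (y + c).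
      by near: y.
    rewrite /L -sumrB; apply: eq_bigr => i _.
    by rewrite mxE addrK mulrBr.
  apply: le_trans (ler_norm_sum _ _ _) _.
  apply: (@le_trans _ _ (\sum_(i < n) `|y| * (eps%:num / n.+1%:R))).
    apply: ler_sum => i _; rewrite normrM ler_pM//.
      by rewrite [leRHS]/Num.Def.normr/= mx_normrE; exact: (le_bigmax _ _ (0, i)).
    by move: i; near: y.
  rewrite sumr_const card_ord -mulrnAr mulrC ler_wpM2r// -mulr_natr mulrAC.
  by rewrite ler_pdivrMr// ler_wpM2l// ler_nat.
have dE := diff_unique Lc fE.
have df : differentiable f c by apply/diff_locallyP; rewrite dE; split.
by split => // v; rewrite deriveE// dE.
Unshelve. all: by end_near. Qed.

End SmoothCalculus.

(** * Real functions of class C^k *)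

Section ScalarSmooth.
Local Open Scope classical_set_scope.
Local Open Scope ring_scope.
Context {R : realType}.

(** Functions of class C^k with real values, the counterpart of [class_C] for
    the coordinates of a vector-valued function. *)
Fixpoint scalar_class_C (n k : nat) (U : set 'rV[R]_n) (f : 'rV[R]_n -> R) : Prop :=
  match k with
  | 0 => forall x, U x -> {for x, continuous f}
  | k'.+1 => (forall x, U x -> differentiable f x) /\
             (forall v : 'rV[R]_n, scalar_class_C k' U (fun x => 'D_v f x))
  end.

Section ScalarClass.
Variables (n : nat) (U : set 'rV[R]_n).
Hypothesis oU : open U.
Implicit Types (f g : 'rV[R]_n -> R) (k : nat).

Lemma eq_on_open_near (W : Type) (f g : 'rV[R]_n -> W) x :
  (forall x, U x -> f x = g x) -> U x -> \near x, f x = g x.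
Proof. by move=> fg Ux; apply: filterS (open_nbhs_nbhs (conj oU Ux)). Qed.

(** Only the values on the open set U matter, although the definition takes
    derivatives of total functions. *)
Lemma scalar_class_C_ext k f g : (forall x, U x -> f x = g x) ->
  scalar_class_C k U f -> scalar_class_C k U g.
Proof.
elim: k f g => [|k IHk] f g fg /=.
  move=> fc x Ux.
  have fgx := eq_on_open_near fg Ux.
  have : f @ x --> f x := fc x Ux.
  by rewrite (fg x Ux) => fcx; exact: cvg_trans (near_eq_cvg fgx) fcx.
move=> [df dfk]; split=> [x Ux|v].
  by apply: near_eq_differentiable (df _ Ux); exact: eq_on_open_near.
apply: IHk (dfk v) => x Ux.
by apply: near_eq_derive; exact: eq_on_open_near.
Qed.

Lemma scalar_class_C_continuous k f x :
  scalar_class_C k U f -> U x -> {for x, continuous f}.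
Proof.
case: k => [|k] /=; first exact.
by move=> [df _] Ux; exact/differentiable_continuous/df.
Qed.

Lemma scalar_class_CW k f : scalar_class_C k.+1 U f -> scalar_class_C k U f.
Proof.
elim: k f => [f fC x|k IHk f [df dfk]]; first exact: scalar_class_C_continuous fC.
by split => // v; exact: IHk.
Qed.

Lemma scalar_class_C_cst k (a : R) : scalar_class_C k U (fun=> a).
Proof.
elim: k a => [|k IHk] a /=; first by move=> x _; exact: cst_continuous.
split=> [x _|v]; first exact: differentiable_cst.
by apply: scalar_class_C_ext (IHk 0) => x _; rewrite derive_cst.
Qed.

Lemma scalar_class_C_coord k (i : 'I_n) :
  scalar_class_C k U (fun x : 'rV[R]_n => x 0 i).
Proof.
have dc x : differentiable (fun x : 'rV[R]_n => x 0 i) x.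
  exact: differentiable_coord.
case: k => [|k] /=; first by move=> x _; exact: coord_continuous.
split=> [x _|v]; first exact: dc.
apply: scalar_class_C_ext (scalar_class_C_cst k (v 0 i)) => x _.
have sumE (u : 'I_n -> R) : \sum_j u j * (j == i)%:R = u i.
  by rewrite (bigD1 i)//= eqxx mulr1 big1 ?addr0// => j /negPf ->; rewrite mulr0.
have dxE (y : 'rV[R]_n) : y 0 i - x 0 i = \sum_j (y 0 j - x 0 j) * (j == i)%:R.
  by rewrite (sumE (fun j => y 0 j - x 0 j)).
have [|_ ->] := @differentiable_caratheodory R n (fun x : 'rV[R]_n => x 0 i)
  (fun j _ => (j == i)%:R) x (fun j => @cst_continuous _ _ _ x).
  by apply: filterE => y; exact: dxE.
by rewrite sumE.
Qed.

Lemma scalar_class_CD k f g : scalar_class_C k U f -> scalar_class_C k U g ->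
  scalar_class_C k U (fun x => f x + g x).
Proof.
elim: k f g => [|k IHk] f g /=.
  by move=> fc gc x Ux; exact: (cvgD (fc x Ux) (gc x Ux)).
move=> [df dfk] [dg dgk]; split=> [x Ux|v].
  exact: differentiableD (df _ Ux) (dg _ Ux).
apply: scalar_class_C_ext (IHk _ _ (dfk v) (dgk v)) => x Ux.
by rewrite -deriveD//; apply: diff_derivable; [exact: df|exact: dg].
Qed.

Lemma scalar_class_CM k f g : scalar_class_C k U f -> scalar_class_C k U g ->
  scalar_class_C k U (fun x => f x * g x).
Proof.
elim: k f g => [|k IHk] f g.
  by move=> fc gc x Ux; exact: (cvgM (fc x Ux) (gc x Ux)).
move=> fC gC; have [df dfk] := fC; have [dg dgk] := gC; split=> [x Ux|v].
  exact: differentiableM (df _ Ux) (dg _ Ux).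
have fCk := scalar_class_CW fC; have gCk := scalar_class_CW gC.
apply: scalar_class_C_ext
  (scalar_class_CD (IHk _ _ fCk (dgk v)) (IHk _ _ gCk (dfk v))) => x Ux.
by rewrite -deriveM//; apply: diff_derivable; [exact: df|exact: dg].
Qed.

Lemma scalar_class_CN k f : scalar_class_C k U f ->
  scalar_class_C k U (fun x => - f x).
Proof.
move=> fC; apply: scalar_class_C_ext
  (scalar_class_CM (scalar_class_C_cst k (-1)) fC) => x _.
by rewrite mulN1r.
Qed.

Lemma scalar_class_CV k f : (forall x, U x -> f x != 0) ->
  scalar_class_C k U f -> scalar_class_C k U (fun x => (f x)^-1).
Proof.
move=> f0; elim: k => [|k IHk].
  by move=> fc x Ux; exact: (cvgV (f0 x Ux) (fc x Ux)).
move=> fC; have [df dfk] := fC; split=> [x Ux|v].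
  exact: differentiableV (df _ Ux) (f0 _ Ux).
have fVk := IHk (scalar_class_CW fC).
apply: scalar_class_C_ext
  (scalar_class_CN (scalar_class_CM (scalar_class_CM fVk fVk) (dfk v))) => x Ux.
rewrite deriveV; [|exact: f0|exact/diff_derivable/df].
by rewrite /GRing.scale/= mulNr expr2 invfM.
Qed.

Lemma scalar_class_C_sum k (I : Type) (r : seq I) (P : pred I)
    (F : I -> 'rV[R]_n -> R) :
  (forall i, P i -> scalar_class_C k U (F i)) ->
  scalar_class_C k U (fun x => \sum_(i <- r | P i) F i x).
Proof.
move=> FC; elim: r => [|i r IHr].
  by apply: scalar_class_C_ext (scalar_class_C_cst k 0) => x _; rewrite big_nil.
case Pi: (P i); last first.
  by apply: scalar_class_C_ext IHr => x _; rewrite big_cons Pi.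
apply: scalar_class_C_ext (scalar_class_CD (FC _ Pi) IHr) => x _.
by rewrite big_cons Pi.
Qed.

Lemma scalar_class_C_prod k (I : Type) (r : seq I) (P : pred I)
    (F : I -> 'rV[R]_n -> R) :
  (forall i, P i -> scalar_class_C k U (F i)) ->
  scalar_class_C k U (fun x => \prod_(i <- r | P i) F i x).
Proof.
move=> FC; elim: r => [|i r IHr].
  by apply: scalar_class_C_ext (scalar_class_C_cst k 1) => x _; rewrite big_nil.
case Pi: (P i); last first.
  by apply: scalar_class_C_ext IHr => x _; rewrite big_cons Pi.
apply: scalar_class_C_ext (scalar_class_CM (FC _ Pi) IHr) => x _.
by rewrite big_cons Pi.
Qed.

Lemma scalar_class_CX k f m : scalar_class_C k U f ->
  scalar_class_C k U (fun x => f x ^+ m).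
Proof.
move=> fC; elim: m => [|m IHm]; first exact: scalar_class_C_cst.
by apply: scalar_class_C_ext (scalar_class_CM fC IHm) => x _; rewrite exprS.
Qed.

Lemma scalar_class_C_det k m (A : 'rV[R]_n -> 'M[R]_m) :
  (forall i j, scalar_class_C k U (fun x => A x i j)) ->
  scalar_class_C k U (fun x => \det (A x)).
Proof.
move=> AC; apply: scalar_class_C_sum => s _.
apply: scalar_class_CM; first exact: scalar_class_C_cst.
by apply: scalar_class_C_prod => i _; exact: AC.
Qed.

Lemma scalar_class_C_invmx k m (A : 'rV[R]_n -> 'M[R]_m) i j :
  (forall x, U x -> A x \in unitmx) ->
  (forall i j, scalar_class_C k U (fun x => A x i j)) ->
  scalar_class_C k U (fun x => invmx (A x) i j).
Proof.
move=> Au AC.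
have cofC : scalar_class_C k U (fun x => cofactor (A x) j i).
  apply: scalar_class_CM; first exact: scalar_class_C_cst.
  apply: scalar_class_C_det => i' j'.
  by apply: scalar_class_C_ext (AC (lift j i') (lift i j')) => x _; rewrite !mxE.
have detV : scalar_class_C k U (fun x => (\det (A x))^-1).
  apply: scalar_class_CV; last exact: scalar_class_C_det.
  by move=> x /Au; rewrite unitmxE unitfE.
apply: scalar_class_C_ext (scalar_class_CM detV cofC) => x Ux.
by rewrite /invmx (Au _ Ux) !mxE.
Qed.

End ScalarClass.

Lemma continuous_rVP (T : topologicalType) p (f : T -> 'rV[R]_p) (x : T) :
  {for x, continuous f} <-> forall j, {for x, continuous (fun y => f y 0 j)}.
Proof.
split=> [fc j|fc].
  exact: continuous_comp fc (@coord_continuous _ _ _ 0 j _).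
apply/cvgrPdist_le => e e0.
have H : \forall y \near x, forall j, `|f x 0 j - f y 0 j| <= e.
  apply: (@filter_forall _ _ _ (nbhs x)) => j.
  by have /cvgrPdist_le/(_ _ e0) := fc j.
apply: filterS H => y H.
rewrite /Num.Def.normr/= mx_normrE (bigmax_le _ (ltW e0))//= => -[i j] _.
by rewrite !mxE/= ord1.
Qed.

Lemma differentiable_rVP (V : normedModType R) p (f : V -> 'rV[R]_p) (x : V) :
  differentiable f x <-> forall j, differentiable (fun y => f y 0 j) x.
Proof.
split=> [df j|df].
  exact: differentiable_comp df (@differentiable_coord _ _ _ _ 0 j).
have -> : f = \sum_(j < p) (fun y => f y 0 j *: delta_mx 0 j).
  apply/funext => y; rewrite fct_sumE; apply/rowP => j.
  rewrite summxE (bigD1 j)//= !mxE !eqxx mulr1 big1 ?addr0// => i ij.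
  by rewrite !mxE eq_sym (negPf ij) andbF mulr0.
by apply: differentiable_sum => j; exact: differentiableZl.
Qed.

Lemma class_C_coordP n p k (U : set 'rV[R]_n) (f : 'rV[R]_n -> 'rV[R]_p) :
  open U ->
  class_C k U f <-> forall j, scalar_class_C k U (fun x => f x 0 j).
Proof.
move=> oU.
have D_coord (g : 'rV[R]_n -> 'rV[R]_p) x v j : differentiable g x ->
    'D_v g x 0 j = 'D_v (fun y => g y 0 j) x.
  by move=> dg; rewrite derive_mx ?mxE//; exact: diff_derivable.
elim: k f => [|k IHk] f /=.
  split=> [fc j x Ux|fc x Ux].
    by move/continuous_rVP : (fc x Ux); exact.
  by apply/continuous_rVP => j; exact: fc.
split=> [[df dfk] j|fC]; last first.
  have df x : U x -> differentiable f x.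
    by move=> Ux; apply/differentiable_rVP => j; have [+ _] := fC j; exact.
  split=> // v; apply/IHk => j; have [_ /(_ v)] := fC j.
  by apply: (scalar_class_C_ext oU) => x Ux; rewrite D_coord//; exact: df.
split=> [x Ux|v]; first by move/differentiable_rVP : (df x Ux); exact.
have /IHk/(_ j) := dfk v.
by apply: (scalar_class_C_ext oU) => x Ux; rewrite D_coord//; exact: df.
Qed.

(** No chain rule is needed: the derivative at y along v of f composed with
    y |-> y *m M + c is, by definition, that of f along v *m M at the image of
    y. *)
Lemma scalar_class_C_affine n p k (U : set 'rV[R]_p) (f : 'rV[R]_p -> R)
    (M : 'M[R]_(n, p)) (c : 'rV[R]_p) (V : set 'rV[R]_n) :
  open V -> (forall y, V y -> U (y *m M + c)) ->
  scalar_class_C k U f -> scalar_class_C k V (fun y => f (y *m M + c)).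
Proof.
move=> oV VU.
have TC : class_C 1 V (fun y => y *m M + c).
  apply/class_C_coordP => // j.
  have : scalar_class_C 1 V (fun y => \sum_i y 0 i * M i j + c 0 j).
    apply: scalar_class_CD (scalar_class_C_cst oV 1 _) => //.
    apply: scalar_class_C_sum => // i _; apply: scalar_class_CM => //.
      exact: scalar_class_C_coord.
    exact: scalar_class_C_cst.
  by apply: (scalar_class_C_ext oV) => y _; rewrite !mxE.
have Td y : V y -> differentiable (fun y => y *m M + c) y by exact: TC.1.
elim: k f => [|k IHk] f.
  move=> fc y Vy.
  have Tc := differentiable_continuous (Td _ Vy).
  exact: (cvg_comp _ _ Tc (fc _ (VU _ Vy))).
move=> [df dfk]; split=> [y Vy|v].
  exact: (differentiable_comp (Td _ Vy) (df _ (VU _ Vy))).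
apply: (scalar_class_C_ext oV) (IHk _ (dfk (v *m M))) => y Vy.
rewrite /derive.
suff -> : (fun h : R => h^-1 *: (((fun y => f (y *m M + c)) \o shift y) (h *: v) -
      f (y *m M + c))) =
    (fun h : R => h^-1 *: ((f \o shift (y *m M + c)) (h *: (v *m M)) -
      f (y *m M + c))) by [].
by apply/funext => h /=; rewrite mulmxDl -scalemxAl addrA.
Qed.

End ScalarSmooth.

(** * Sets cut out by affine equations in a chart *)

Section AffineChart.
Local Open Scope classical_set_scope.
Local Open Scope ring_scope.
Context {R : realType}.

Lemma continuous_affine n p (N : 'M[R]_(n, p)) (c : 'rV[R]_p) :
  continuous (fun y : 'rV[R]_n => y *m N + c).
Proof.
move=> y; apply/continuous_rVP => j.
have : @scalar_class_C R n 0 setT (fun y => \sum_i y 0 i * N i j + c 0 j).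
  apply: scalar_class_CD (scalar_class_C_cst openT 0 _); first exact: openT.
  apply: scalar_class_C_sum => [|i _]; first exact: openT.
  apply: scalar_class_CM; [exact: openT|exact/scalar_class_C_coord/openT|].
  exact/scalar_class_C_cst/openT.
move=> H; suff <- : (fun y : 'rV[R]_n => \sum_i y 0 i * N i j + c 0 j) =
   (fun y : 'rV[R]_n => (y *m N + c) 0 j) by exact: H.
by apply/funext => z; rewrite !mxE.
Qed.

(** In the coordinates v *m col_ebase A the kernel of A is cut out by the
    vanishing of the first \rank A coordinates; the permutation [rev_ord] moves these
    to the end, where [coord_slice] expects the vanishing coordinates. *)
Lemma straighten_kernel n s (A : 'M[R]_(n, s)) :
  exists2 N : 'M[R]_n, N \in unitmx &
    forall v : 'rV[R]_n, v *m A = 0 <-> coord_slice (n - \rank A) (v *m N).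
Proof.
pose sg : 'S_n := perm (@rev_ord_inj n).
exists (col_ebase A *m perm_mx sg^-1%g).
  by rewrite unitmx_mul col_ebase_unit unitmx_perm.
move=> v; rewrite mulmxA -col_permE.
set w := v *m col_ebase A.
have -> : v *m A = w *m pid_mx (\rank A) *m row_ebase A.
  by rewrite /w -!mulmxA; congr (_ *m _); rewrite mulmxA mulmx_ebase.
have le_rn := rank_leq_row A; have le_rs := rank_leq_col A.
have wE (j : 'I_s) : (w *m pid_mx (\rank A) : 'rV_s) 0 j =
    \sum_i w 0 i * ((i == j :> nat) && (i < \rank A)%N)%:R.
  rewrite mxE; apply: eq_bigr => i _; congr (_ * _); rewrite mxE.
split=> [w0 i im|w0].
split=> [w0 i im|w0].
  have wr0 : w *m pid_mx (\rank A) = 0 :> 'rV_s.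
    have := congr1 (mulmx^~ (invmx (row_ebase A))) w0.
    by rewrite /= mulmxK ?row_ebase_unit// mul0mx.
  have lt_ir : (rev_ord i < \rank A)%N by have := ltn_ord i; rewrite /=; lia.
  rewrite mxE permE.
  have := wE (Ordinal (leq_trans lt_ir le_rs)); rewrite wr0 mxE.
  rewrite (bigD1 (rev_ord i))//= eqxx lt_ir mulr1 big1 ?addr0// => j ji.
  by rewrite -val_eqE/= in ji; rewrite (negPf ji) mulr0.
suff -> : w *m pid_mx (\rank A) = 0 :> 'rV_s by rewrite mul0mx.
apply/rowP => j; rewrite wE mxE big1// => i _.
case: eqP => [ij|]; last by rewrite mulr0.
case: ltnP => [ir|]; last by rewrite mulr0.
have := w0 (rev_ord i); rewrite mxE permE rev_ordK => ->; first by rewrite mul0r.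
by have := ltn_ord i; rewrite /=; lia.
Qed.

Lemma is_submanifold_affine_chart n s (M V S : set 'rV[R]_n)
    (h : 'rV[R]_n -> 'rV[R]_n) (A : 'M[R]_(n, s)) (b : 'rV[R]_s) :
  diffeomorphism M V h -> S `<=` M ->
  (forall x, M x -> S x <-> h x *m A = b) ->
  is_submanifold M S.
Proof.
move=> [oM oV hC hV [g [gC gh]]] SM SE.
have [N Nu NE] := straighten_kernel A.
exists (n - \rank A)%N; split => //; first exact: leq_subr.
move=> p Sp; have Mp := SM _ Sp; have hpb := (SE _ Mp).1 Sp.
pose T y := (y - h p) *m N.
pose T' z := z *m invmx N + h p.
have TK : cancel T T' by move=> y; rewrite /T /T' mulmxK ?subrK.
have T'K : cancel T' T by move=> y; rewrite /T /T' addrK mulmxKV.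
exists M, (T' @^-1` V), (T \o h).
have VT x : V (h x) -> (T' @^-1` V) (T (h x)) by rewrite /= TK.
have oV' : open (T' @^-1` V).
  by apply: open_comp oV => y _; exact: continuous_affine.
split=> //.
- split=> //.
  + move=> k; apply/class_C_coordP => // j.
    have : scalar_class_C k M (fun x => \sum_i (h x 0 i + - h p 0 i) * N i j).
      apply: scalar_class_C_sum => // i _.
      apply: scalar_class_CM => //; last exact: scalar_class_C_cst.
      apply: scalar_class_CD => //; last exact: scalar_class_C_cst.
      by move/class_C_coordP : (hC k); exact.
    apply: (scalar_class_C_ext oM) => x _; rewrite /T /= mxE.
    by apply: eq_bigr => i _; rewrite !mxE.
  + rewrite -hV; apply/seteqP; split=> [_ [x Mx <-]|z [x Mx hx]] /=.
      by rewrite TK; exists x.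
    by exists x => //=; rewrite hx T'K.
  + exists (g \o T'); split=> [k|x Mx]; last by rewrite /= TK gh.
    apply/class_C_coordP => // j.
    apply: (@scalar_class_C_affine _ _ _ _ V (fun y => g y 0 j)) => //.
    by move/class_C_coordP : (gC k); exact.
- have SE' x : M x -> S x <-> coord_slice (n - \rank A) (T (h x)).
    move=> Mx; apply: (iff_trans (SE _ Mx)).
    apply: iff_trans (NE (h x - h p)); rewrite mulmxBl hpb.
    by split=> [->|/eqP]; rewrite ?subrr// subr_eq0 => /eqP.
  apply/seteqP; split=> [_ [x [Mx Sx] <-]|z [Vz zm]].
    by split; [apply: VT; rewrite -hV; exists x|exact/SE'].
  move: Vz; rewrite /= -hV => -[x Mx hx].
  have zE : T (h x) = z by rewrite hx T'K.
  by exists x => //; split=> //; apply/SE' => //; rewrite zE.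
Qed.

End AffineChart.

(** * The Vieta map *)

Section Vieta.
Local Open Scope classical_set_scope.
Local Open Scope ring_scope.
Context {R : realType} {d : nat}.
Implicit Types (x c v : 'rV[R]_d).

(** The monic polynomial whose roots are the nodes. *)
Definition node_poly x : {poly R} := \prod_(j < d) ('X - (x 0 j)%:P).

(** The Vieta map: the d lower coefficients of [node_poly x], in increasing
    degree; the leading coefficient is 1. *)
Definition vieta x : 'rV[R]_d := poly_rV (node_poly x).

(** The monic polynomial of degree d with lower coefficients c. *)
Definition monic_of c : {poly R} := 'X^d + rVpoly c.

Lemma size_node_poly x : size (node_poly x) = d.+1.
Proof. by rewrite size_prod_XsubC -[index_enum _]enumT size_enum_ord. Qed.

Lemma node_poly_monic x : node_poly x \is monic.
Proof. exact: monic_prod_XsubC. Qed.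

Lemma size_monic_of c : size (monic_of c) = d.+1.
Proof. by rewrite size_polyDl ?size_polyXn// ltnS size_poly. Qed.

Lemma monic_of_monic c : monic_of c \is monic.
Proof.
by rewrite monicE lead_coefDl ?lead_coefXn// size_polyXn ltnS size_poly.
Qed.

Lemma coef_monic_of c (i : 'I_d) : (monic_of c)`_i = c 0 i.
Proof. by rewrite coefD coefXn ltn_eqF ?add0r// coef_rVpoly_ord. Qed.

Lemma monic_of_vieta x : monic_of (vieta x) = node_poly x.
Proof.
apply/polyP => i; case: (ltngtP i d) => [id|di|->].
- by rewrite (coef_monic_of _ (Ordinal id)) mxE.
- by rewrite !nth_default ?size_node_poly ?size_monic_of.
- have := node_poly_monic x; have := monic_of_monic (vieta x).
  by rewrite !monicE !lead_coefE size_node_poly size_monic_of => /eqP-> /eqP->.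
Qed.

Lemma monic_of_eq_node_poly x c : monic_of c = node_poly x -> vieta x = c.
Proof. by move=> cx; apply/rowP => i; rewrite mxE -cx coef_monic_of. Qed.

Lemma horner_monic_of c t : (monic_of c).[t] = t ^+ d + \sum_i c 0 i * t ^+ i.
Proof.
rewrite hornerD hornerXn horner_poly; congr (_ + _); apply: eq_bigr => i _.
by rewrite insubT//= => ?; congr (c 0 _ * _); exact: val_inj.
Qed.

Lemma horner_node_poly x t : (node_poly x).[t] = \prod_j (t - x 0 j).
Proof. by rewrite horner_prod; apply: eq_bigr => j _; rewrite hornerXsubC. Qed.

Lemma node_space_inj x i j : node_space d x -> (x 0 i == x 0 j) = (i == j).
Proof.
move=> Px; apply/eqP/eqP => [xij|->//]; apply/val_inj.
by case: (ltngtP i j) => // /Px; rewrite xij ltxx.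
Qed.

Lemma node_seq_sorted x : node_space d x -> sorted <%R [seq x 0 j | j <- enum 'I_d].
Proof.
move=> Px; apply: (homo_sorted (e := fun i j : 'I_d => (i < j)%N)).
  by move=> i j; exact: Px.
have := iota_ltn_sorted 0 d; rewrite -val_enum_ord sorted_map; exact.
Qed.

Lemma vieta_inj x y : node_space d x -> node_space d y -> vieta x = vieta y -> x = y.
Proof.
move=> Px Py xy.
have Qxy : node_poly x = node_poly y by rewrite -!monic_of_vieta xy.
have rootE z t : root (node_poly z) t = (t \in [seq z 0 j | j <- enum 'I_d]).
  rewrite -root_prod_XsubC big_map /node_poly.
  by rewrite -[index_enum _]enumT.
have : [seq x 0 j | j <- enum 'I_d] = [seq y 0 j | j <- enum 'I_d].
  apply: lt_sorted_eq; [exact: node_seq_sorted..|].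
  by move=> t; rewrite -!rootE Qxy.
by move/eq_in_map => xy'; apply/rowP => j; apply: xy'; rewrite mem_enum.
Qed.

Lemma scalar_class_C_vieta n k (U : set 'rV[R]_n) (X : 'rV[R]_n -> 'rV[R]_d) i :
  open U -> (forall j, scalar_class_C k U (fun y => X y 0 j)) ->
  scalar_class_C k U (fun y => vieta (X y) 0 i).
Proof.
move=> oU XC.
suff H m (r : seq 'I_d) :
    scalar_class_C k U (fun y => (\prod_(j <- r) ('X - (X y 0 j)%:P))`_m).
  by apply: (scalar_class_C_ext oU) (H i (index_enum _)) => y _; rewrite mxE.
elim: r m => [|j r IHr] m.
  apply: (scalar_class_C_ext oU) (scalar_class_C_cst oU k (1 : {poly R})`_m) => y _.
  by rewrite big_nil.
have C1 : scalar_class_C k U (fun y => if m == 0%N then 0 else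
    (\prod_(j <- r) ('X - (X y 0 j)%:P))`_m.-1).
  by case: m => [|m] /=; [exact: scalar_class_C_cst|exact: IHr].
apply: (scalar_class_C_ext oU)
  (scalar_class_CD oU C1 (scalar_class_CN oU (scalar_class_CM oU (XC j) (IHr m)))).
by move=> y _; rewrite big_cons mulrBl coefB coefXM coefCM.
Qed.

(** Roots move little with the coefficients: near [vieta x] every coefficient
    vector comes from nodes close to x. *)
Lemma vieta_local_surj x e : node_space d x -> 0 < e ->
  \forall c \near vieta x,
    exists y, [/\ node_space d y, vieta y = c & forall j, `|y 0 j - x 0 j| < e].
Proof.
move=> Px e0.
(* D is so small that the intervals [x_j - D, x_j + D] are disjoint. *)
have [D [D0 De Dx]] : exists D, [/\ 0 < D, D <= e &
    forall i j : 'I_d, (i < j)%N -> x 0 i + D < x 0 j - D].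
  have H : \forall D \near 0^'+, forall ij : 'I_d * 'I_d, (ij.1 < ij.2)%N ->
      x 0 ij.1 + D < x 0 ij.2 - D.
    apply: filter_forall => -[i j] /=.
    case: (ltnP i j) => [ij|]; last by move=> _; apply: filterE.
    have xij : 0 < (x 0 j - x 0 i) / 2 by rewrite divr_gt0// subr_gt0 Px.
    near=> D => _.
    have : D < (x 0 j - x 0 i) / 2 by near: D; exact: nbhs_right_lt.
    lra.
  have : \forall D \near 0^'+, [/\ 0 < D, D <= e &
    forall i j : 'I_d, (i < j)%N -> x 0 i + D < x 0 j - D].
    near=> D; split.
    - by near: D; exact: nbhs_right_gt.
    - by near: D; exact: nbhs_right_le.
    - by move=> i j ij; apply: (near H D _ (i, j)).
  by move/filter_ex.
(* The product is \prod_i ((x_j - x_i)^2 - D^2), negative for i = j only. *)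
have sgn0 j : (node_poly x).[x 0 j - D] * (node_poly x).[x 0 j + D] < 0.
  rewrite !horner_node_poly -big_split/= (bigD1 j)//= nmulr_rlt0; last first.
    by rewrite addrAC subrr sub0r addrAC subrr add0r mulNr oppr_lt0 mulr_gt0.
  apply: prodr_gt0 => i ij.
  have : (i < j)%N || (j < i)%N by rewrite -neq_ltn.
  by case/orP => /Dx ?; [apply: mulr_gt0|rewrite nmulr_rgt0]; lra.
have sgn : \forall c \near vieta x, forall j,
    (monic_of c).[x 0 j - D] * (monic_of c).[x 0 j + D] < 0.
  apply: (@filter_forall _ _ _ (nbhs (vieta x))) => j.
  have hc t : {for vieta x, continuous (fun c => (monic_of c).[t])}.
    have : @scalar_class_C R d 0 setT (fun c => t ^+ d + \sum_i c 0 i * t ^+ i).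
      apply: scalar_class_CD (scalar_class_C_cst openT 0 _) _; first exact: openT.
      apply: scalar_class_C_sum => [|i _]; first exact: openT.
      apply: scalar_class_CM; [exact: openT|exact/scalar_class_C_coord/openT|].
      exact/scalar_class_C_cst/openT.
    move=> H; suff -> : (fun c => (monic_of c).[t]) =
      (fun c => t ^+ d + \sum_i c 0 i * t ^+ i) by exact: H.
    by apply/funext => c; rewrite horner_monic_of.
  apply: (cvgr_lt _ (cvgM (hc (x 0 j - D)) (hc (x 0 j + D)))).
  by rewrite monic_of_vieta.
apply: filterS sgn => c sgn.
have rt j : {t | t \in `]x 0 j - D, x 0 j + D[ & root (monic_of c) t}.
  by apply: polyrcf.poly_ivtoo (sgn j); lra.
pose y : 'rV[R]_d := \row_j s2val (rt j).
have yD j : `|y 0 j - x 0 j| < D.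
  rewrite mxE; case: (rt j) => t /=; rewrite in_itv/= => /andP[t1 t2] _.
  by rewrite ltr_norml; lra.
have Py : node_space d y.
  move=> i j ij; have := Dx _ _ ij; have := yD i; have := yD j.
  rewrite !ltr_norml; lra.
exists y; split=> //; last by move=> j; exact: lt_le_trans De.
apply: monic_of_eq_node_poly.
rewrite (@all_roots_prod_XsubC _ (monic_of c) [seq y 0 j | j <- enum 'I_d]).
- by rewrite (monicP (monic_of_monic c)) scale1r big_map /node_poly -[index_enum _]enumT.
- by rewrite size_map size_enum_ord size_monic_of.
- apply/allP => _ /mapP[j _ ->]; rewrite mxE; by case: (rt j).
- rewrite uniq_rootsE map_inj_in_uniq ?enum_uniq// => i j _ _ /eqP.
  by rewrite node_space_inj// => /eqP.
Unshelve. all: by end_near. Qed.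

End Vieta.

(** * Smoothness of the ordered roots *)

Section Roots.
Local Open Scope classical_set_scope.
Local Open Scope ring_scope.
Context {R : realType} {d : nat}.
Implicit Types (x c v : 'rV[R]_d).

(** Coefficients of the monic polynomials of degree d with d distinct real
    roots. *)
Definition hyperbolic : set 'rV[R]_d := vieta @` node_space d.

(** The inverse of the Vieta map: the roots of [monic_of c] in increasing order,
    and 0 when c is not hyperbolic. *)
Definition sorted_roots c : 'rV[R]_d := xget 0 [set x | node_space d x /\ vieta x = c].

Lemma vietaK x : node_space d x -> sorted_roots (vieta x) = x.
Proof.
move=> Px; have [|Py xy] := @xgetPex _ 0 [set y | node_space d y /\ vieta y = vieta x].
  by exists x.
exact: vieta_inj.
Qed.

Lemma sorted_rootsP c : hyperbolic c ->
  node_space d (sorted_roots c) /\ vieta (sorted_roots c) = c.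
Proof. by move=> [x Px <-]; rewrite vietaK. Qed.

Lemma open_node_space : open (@node_space R d).
Proof.
rewrite openE => x Px.
have H : \forall y \near x, forall ij : 'I_d * 'I_d, (ij.1 < ij.2)%N ->
    (y : 'rV[R]_d) 0 ij.1 < y 0 ij.2.
  apply: (@filter_forall _ _ _ (nbhs x)) => -[i j] /=.
  case: (ltnP i j) => [ij|]; last by move=> _; apply: filterE.
  have H : \forall y \near x, 0 < (y : 'rV[R]_d) 0 j - y 0 i.
    apply: (cvgr_gt _ (cvgB (@coord_continuous _ _ _ 0 j x)
                           (@coord_continuous _ _ _ 0 i x))).
    by rewrite subr_gt0 Px.
  by apply: filterS H => y; rewrite subr_gt0.
by apply: filterS H => y H i j ij; exact: (H (i, j)).
Qed.

Lemma open_hyperbolic : open hyperbolic.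
Proof.
rewrite openE => _ [x Px <-].
apply: filterS (vieta_local_surj Px ltr01) => c [y [Py <- _]].
by exists y.
Qed.

Lemma continuous_sorted_roots c j : hyperbolic c ->
  {for c, continuous (fun c => sorted_roots c 0 j)}.
Proof.
move=> [x Px <-]; apply/(@cvgrPdist_lt _ _ _ (nbhs (vieta x))) => e e0.
apply: filterS (vieta_local_surj Px e0) => _ [y [Py <- yx]].
by rewrite !vietaK// distrC.
Qed.

(** Both sides are the value at y_j of the polynomial with roots x, using that
    the polynomial with roots y vanishes there. *)
Lemma sorted_roots_diffE x y j : node_space d x -> node_space d y ->
  (y 0 j - x 0 j) * \prod_(l | l != j) (y 0 j - x 0 l) =
  - \sum_i (vieta y 0 i - vieta x 0 i) * y 0 j ^+ i.
Proof.
move=> Px Py.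
have y0 : (monic_of (vieta y)).[y 0 j] = 0.
  by rewrite monic_of_vieta horner_node_poly (bigD1 j)//= subrr mul0r.
have : (monic_of (vieta x)).[y 0 j] = \prod_l (y 0 j - x 0 l).
  by rewrite monic_of_vieta horner_node_poly.
rewrite [RHS](bigD1 j)//= => <-; apply/eqP; rewrite -subr_eq0 opprK.
rewrite -[eqbRHS]y0 !horner_monic_of -addrA; apply/eqP; congr (_ + _).
by rewrite -big_split; apply: eq_bigr => i _ /=; rewrite mulrBl addrC subrK.
Qed.

(** The derivative of a root is a rational function of the roots, whose
    denominator is the derivative of the polynomial at that root. *)
Lemma derive_sorted_roots c j : hyperbolic c ->
  differentiable (fun c => sorted_roots c 0 j) c /\
  forall v, 'D_v (fun c => sorted_roots c 0 j) c = \sum_i v 0 i *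
    - (sorted_roots c 0 j ^+ i /
       \prod_(l | l != j) (sorted_roots c 0 j - sorted_roots c 0 l)).
Proof.
move=> Hc; have [Px xc] := sorted_rootsP Hc; set x := sorted_roots c in Px xc *.
have oH := open_hyperbolic.
have rC i : scalar_class_C 0 hyperbolic (fun c => sorted_roots c 0 i).
  by move=> c' Hc'; exact: continuous_sorted_roots.
pose K c' := \prod_(l | l != j) (sorted_roots c' 0 j - x 0 l).
have Kc : {for c, continuous K}.
  suff H : scalar_class_C 0 hyperbolic K by exact: H.
  apply: scalar_class_C_prod => // l _; apply: scalar_class_CD => //.
  exact: scalar_class_C_cst.
have K0 : K c != 0.
  by apply/prodf_neq0 => l lj; rewrite subr_eq0 node_space_inj// eq_sym.
apply: (differentiable_caratheodory
  (A := fun (i : 'I_d) c' => - (sorted_roots c' 0 j ^+ i / K c'))).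
  move=> i.
  have Xc : {for c, continuous (fun c => sorted_roots c 0 j ^+ i)}.
    suff H : scalar_class_C 0 hyperbolic (fun c => sorted_roots c 0 j ^+ i) by exact: H.
    exact: scalar_class_CX.
  exact: (cvgN (cvgM Xc (cvgV K0 Kc))).
have near_hyp : \forall c' \near c, hyperbolic c'.
  exact: open_nbhs_nbhs (conj open_hyperbolic Hc).
have near_K : \forall c' \near c, K c' != 0.
  exact: (cvgr_neq0 _ Kc K0).
apply: filterS2 near_hyp near_K => c' Hc' K0'.
have [Py yc'] := sorted_rootsP Hc'.
have := sorted_roots_diffE j Px Py; rewrite xc yc' -/(K c') => E.
apply: (mulIf K0'); rewrite E -mulrN1 !mulr_suml; apply: eq_bigr => i _.
by field.
Qed.

Lemma scalar_class_C_sorted_roots k j :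
  scalar_class_C k hyperbolic (fun c => sorted_roots c 0 j).
Proof.
elim: k j => [|k IHk] j; first by move=> c Hc; exact: continuous_sorted_roots.
split=> [c Hc|v]; first by have [] := derive_sorted_roots j Hc.
have oH := open_hyperbolic.
have : scalar_class_C k hyperbolic (fun c => \sum_i v 0 i *
    - (sorted_roots c 0 j ^+ i /
       \prod_(l | l != j) (sorted_roots c 0 j - sorted_roots c 0 l))).
  apply: scalar_class_C_sum => // i _.
  apply: scalar_class_CM => //; first exact: scalar_class_C_cst.
  apply: scalar_class_CN => //; apply: scalar_class_CM => //.
    exact: scalar_class_CX.
  apply: scalar_class_CV => //.
    move=> c Hc; apply/prodf_neq0 => l lj.
    by rewrite subr_eq0 node_space_inj 1?eq_sym//; exact: (sorted_rootsP Hc).1.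
  apply: scalar_class_C_prod => // l _; apply: scalar_class_CD => //.
  exact: scalar_class_CN.
apply: (scalar_class_C_ext oH) => c Hc.
by have [_ ->] := derive_sorted_roots j Hc.
Qed.

End Roots.

(** * Charts of the space of nodes and of the Prony space *)

Section PronyCharts.
Local Open Scope classical_set_scope.
Local Open Scope ring_scope.
Context {R : realType} {d : nat}.
Implicit Types (a x c v : 'rV[R]_d) (p y : 'rV[R]_(d + d)).

Lemma diffeomorphism_vieta :
  diffeomorphism (node_space d) hyperbolic (@vieta R d).
Proof.
have oP := @open_node_space R d; have oH := @open_hyperbolic R d.
split=> // [k|].
  apply/class_C_coordP => // j; apply: (@scalar_class_C_vieta _ _ _ _ _ id) => // i.
  exact: scalar_class_C_coord.
exists sorted_roots; split; last exact: vietaK.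
by move=> k; apply/class_C_coordP => // j; exact: scalar_class_C_sorted_roots.
Qed.

(** The moment of order k of the measure with amplitudes a at the nodes x. *)
Definition moment a x (k : nat) : R := \sum_j a 0 j * x 0 j ^+ k.

Lemma moment_Vandermonde a x (k : 'I_d) :
  (a *m (Vandermonde d x)^T) 0 k = moment a x k.
Proof. by rewrite mxE; apply: eq_bigr => j _; rewrite !mxE. Qed.

Lemma Vandermonde_unit x : node_space d x -> (Vandermonde d x)^T \in unitmx.
Proof.
move=> Px; rewrite unitmx_tr unitmxE unitfE det_Vandermonde.
apply/prodf_neq0 => i _; apply/prodf_neq0 => j ij.
by rewrite subr_eq0 node_space_inj// neq_ltn ij orbT.
Qed.

(** The chart (a, x) |-> (c, m): Vieta coefficients of the nodes and moments of
    order 0, ..., d - 1. *)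
Definition prony_chart p : 'rV[R]_(d + d) :=
  row_mx (vieta (nodes p)) (amplitudes p *m (Vandermonde d (nodes p))^T).

(** Nodes are recovered from c, then amplitudes by solving the Vandermonde
    system for m. *)
Definition prony_chart_inv y : 'rV[R]_(d + d) :=
  row_mx (rsubmx y *m invmx (Vandermonde d (sorted_roots (lsubmx y)))^T)
         (sorted_roots (lsubmx y)).

Lemma class_C_row_mx n m1 m2 k (U : set 'rV[R]_n) (f : 'rV[R]_n -> 'rV[R]_m1)
    (g : 'rV[R]_n -> 'rV[R]_m2) : open U ->
  (forall j, scalar_class_C k U (fun z => f z 0 j)) ->
  (forall j, scalar_class_C k U (fun z => g z 0 j)) ->
  class_C k U (fun z => row_mx (f z) (g z)).
Proof.
move=> oU fC gC; apply/class_C_coordP => // j.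
by case: (split_ordP j) => i ->;
  [apply: (scalar_class_C_ext oU) (fC i)|apply: (scalar_class_C_ext oU) (gC i)];
  move=> z _; rewrite ?row_mxEl ?row_mxEr.
Qed.

Lemma lsubmxE y : lsubmx y = y *m col_mx 1%:M 0 + 0.
Proof. by rewrite -[in RHS](hsubmxK y) mul_row_col mulmx1 mulmx0 !addr0. Qed.

Lemma rsubmxE y : rsubmx y = y *m col_mx 0 1%:M + 0.
Proof. by rewrite -[in RHS](hsubmxK y) mul_row_col mulmx1 mulmx0 add0r addr0. Qed.

Lemma open_prony_space : open (@prony_space R d).
Proof.
have -> : @prony_space R d =
    (fun y => y *m col_mx 0 1%:M + 0) @^-1` (@node_space R d).
  by apply/funext => y; rewrite /prony_space /nodes /= -rsubmxE.
by apply: open_comp open_node_space => y _; exact: continuous_affine.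
Qed.

Lemma open_hyperbolic_lsubmx :
  open [set y : 'rV[R]_(d + d) | hyperbolic (lsubmx y)].
Proof.
have -> : [set y : 'rV[R]_(d + d) | hyperbolic (lsubmx y)] =
    (fun y => y *m col_mx 1%:M 0 + 0) @^-1` (@hyperbolic R d).
  by apply/funext => y; rewrite /= -lsubmxE.
by apply: open_comp open_hyperbolic => y _; exact: continuous_affine.
Qed.

Lemma diffeomorphism_prony_chart :
  diffeomorphism (prony_space d) [set y | hyperbolic (lsubmx y)] prony_chart.
Proof.
have oP := open_prony_space; have oH := open_hyperbolic_lsubmx.
have chartK p : prony_space d p -> prony_chart_inv (prony_chart p) = p.
  move=> Pp; rewrite /prony_chart_inv /prony_chart row_mxKl row_mxKr vietaK//.
  by rewrite mulmxK ?Vandermonde_unit// hsubmxK.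
split=> //.
- move=> k; apply: class_C_row_mx => // j.
    apply: scalar_class_C_vieta => // i.
    apply: (scalar_class_C_ext oP) (scalar_class_C_coord oP k (rshift d i)) => p _.
    by rewrite mxE.
  have : scalar_class_C k (prony_space d)
      (fun p : 'rV[R]_(d + d) => \sum_i p 0 (lshift d i) * p 0 (rshift d i) ^+ j).
    apply: scalar_class_C_sum => // i _; apply: scalar_class_CM => //.
      exact: scalar_class_C_coord.
    by apply: scalar_class_CX => //; exact: scalar_class_C_coord.
  apply: (scalar_class_C_ext oP) => p _.
  by rewrite moment_Vandermonde; apply: eq_bigr => i _; rewrite !mxE.
- apply/seteqP; split=> [_ [p Pp <-]|y Hy] /=.
    by rewrite row_mxKl; exists (nodes p).
  have [Px xy] := sorted_rootsP Hy.
  exists (prony_chart_inv y); first by rewrite /prony_space/= /nodes row_mxKr.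
  rewrite /prony_chart /nodes /amplitudes row_mxKl row_mxKr xy.
  by rewrite mulmxKV ?Vandermonde_unit// hsubmxK.
exists prony_chart_inv; split=> // k.
have rC j : scalar_class_C k [set y : 'rV[R]_(d + d) | hyperbolic (lsubmx y)]
    (fun y => sorted_roots (lsubmx y) 0 j).
  have : scalar_class_C k [set y : 'rV[R]_(d + d) | hyperbolic (lsubmx y)]
      (fun y => sorted_roots (y *m col_mx 1%:M 0 + 0) 0 j).
    apply: (@scalar_class_C_affine _ _ _ _ hyperbolic
      (fun c => sorted_roots c 0 j)) => //.
      by move=> y; rewrite /= lsubmxE.
    exact: scalar_class_C_sorted_roots.
  by apply: (scalar_class_C_ext oH) => y _; rewrite -lsubmxE.
apply: class_C_row_mx => // j.
have : scalar_class_C k [set y : 'rV[R]_(d + d) | hyperbolic (lsubmx y)]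
    (fun y => \sum_i y 0 (rshift d i) *
       invmx (Vandermonde d (sorted_roots (lsubmx y)))^T i j).
  apply: scalar_class_C_sum => // i _; apply: scalar_class_CM => //.
    exact: scalar_class_C_coord.
  apply: scalar_class_C_invmx => //.
    by move=> y Hy; apply: Vandermonde_unit; exact: (sorted_rootsP Hy).1.
  move=> i' j'; apply: (scalar_class_C_ext oH) (scalar_class_CX oH j' (rC i')).
  by move=> y _; rewrite !mxE.
apply: (scalar_class_C_ext oH) => y _.
by rewrite [RHS]mxE; apply: eq_bigr => i _; rewrite [rsubmx y _ _]mxE.
Qed.

(** * The Prony equations in the charts *)

Lemma moment_recurrence a x k :
  moment a x (d + k) = - \sum_(i < d) vieta x 0 i * moment a x (k + i).
Proof.
apply/eqP; rewrite -addr_eq0; apply/eqP.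
transitivity (\sum_j a 0 j * x 0 j ^+ k * (monic_of (vieta x)).[x 0 j]).
  under [RHS]eq_bigr do rewrite horner_monic_of mulrDr mulr_sumr.
  rewrite big_split/= [X in _ = _ + X]exchange_big/=; congr (_ + _).
    by apply: eq_bigr => j _; rewrite exprD; ring.
  apply: eq_bigr => i _; rewrite mulr_sumr; apply: eq_bigr => j _.
  by rewrite exprD; ring.
apply: big1 => j _.
by rewrite monic_of_vieta horner_node_poly (bigD1 j)//= subrr mul0r mulr0.
Qed.

Lemma moments_hankel (m : nat -> R) a x q :
  (forall k, (k <= q)%N -> moment a x k = m k) <->
  (forall k, (k <= q)%N -> if (k < d)%N then moment a x k = m k
     else \sum_(i < d) vieta x 0 i * m (k - d + i)%N = - m k).
Proof.
split=> [am k kq|H].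
  case: ltnP => kd; first exact: am.
  have := moment_recurrence a x (k - d); rewrite subnKC// am// => ->.
  rewrite opprK; apply: eq_bigr => i _; rewrite am//.
  by have := ltn_ord i; lia.
elim/ltn_ind => k IHk kq; have := H _ kq; case: ltnP => // kd /eqP.
rewrite eq_sym eqr_oppLR => /eqP ->.
rewrite -{1}(subnKC kd) moment_recurrence; congr (- _).
apply: eq_bigr => i _; rewrite IHk//; have := ltn_ord i; lia.
Qed.

Variables (q : nat) (mu : 'rV[R]_(2 * d)).
Hypothesis hq : (q < 2 * d)%N.

(** The sequence mu_0, ..., mu_(2d-1), continued by 0. *)
Definition mu_seq (k : nat) : R := if insub k is Some i then mu 0 i else 0.

(** The coefficients, in the variables c, of the equations of order
    k = 0, ..., q.  There is no condition on c when k < d, hence a zero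
    column. *)
Definition hankel : 'M[R]_(d, q.+1) :=
  \matrix_(i, k) if (k < d)%N then 0 else mu_seq (k - d + i).

Lemma prony_varietyP p : prony_variety q mu p <->
  prony_space d p /\
  forall k, (k <= q)%N -> moment (amplitudes p) (nodes p) k = mu_seq k.
Proof.
split=> -[Pp H]; split=> // k kq.
  have kd : (k < 2 * d)%N by exact: leq_ltn_trans hq.
  by rewrite /mu_seq insubT; exact: (H (Ordinal kd)).
by rewrite -/(moment _ _ _) H// /mu_seq valK.
Qed.

Lemma hankelP x : vieta x *m hankel = \row_k (if (k < d)%N then 0 else - mu_seq k) <->
  (forall k, (k <= q)%N -> if (k < d)%N then True
     else \sum_(i < d) vieta x 0 i * mu_seq (k - d + i)%N = - mu_seq k).
Proof.
split=> [H k kq|H].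
  case: ltnP => // kd; have /rowP/(_ (Ordinal (kq : k < q.+1)%N)) := H.
  rewrite !mxE/= ltnNge kd/= => <-; apply: eq_bigr => i _.
  by rewrite [hankel _ _]mxE/= ltnNge kd.
apply/rowP => k; rewrite !mxE; have := H k (ltn_ord k).
case: ltnP => kd; last first.
  by move=> <-; apply: eq_bigr => i _; rewrite [hankel _ _]mxE ltnNge kd.
by move=> _; apply: big1 => i _; rewrite [hankel _ _]mxE kd mulr0.
Qed.

Lemma is_submanifold_prony_nodes :
  is_submanifold (node_space d) (prony_nodes q mu).
Proof.
apply: (is_submanifold_affine_chart diffeomorphism_vieta (A := hankel)
  (b := \row_k (if (k < d)%N then 0 else - mu_seq k))).
  by move=> _ [p [Pp _] <-].
move=> x Px; rewrite hankelP; split.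
  move=> [p /prony_varietyP[_ /moments_hankel H] <-] k /H.
  by case: ltnP.
move=> H.
(* The amplitudes with prescribed moments of order less than d. *)
pose a := (\row_(k < d) mu_seq k) *m invmx (Vandermonde d x)^T.
exists (row_mx a x); last exact: row_mxKr.
apply/prony_varietyP; rewrite /prony_space /amplitudes /nodes /= row_mxKl row_mxKr.
split=> //; apply/moments_hankel => k /H.
case: ltnP => // kd _; rewrite -(moment_Vandermonde a x (Ordinal kd)).
by rewrite mulmxKV ?Vandermonde_unit// mxE.
Qed.

Lemma is_submanifold_prony_variety :
  is_submanifold (prony_space d) (prony_variety q mu).
Proof.
(* For k >= d the k-th column of the lower block is zero, as j < d. *)
pose A : 'M[R]_(d + d, q.+1) :=
  col_mx hankel (\matrix_(j, k) (k == j :> nat)%:R).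
apply: (is_submanifold_affine_chart diffeomorphism_prony_chart (A := A)
  (b := \row_k (if (k < d)%N then mu_seq k else - mu_seq k))).
  by move=> p [].
move=> p Pp.
set a := amplitudes p; set x := nodes p.
have cE (k : 'I_q.+1) : (prony_chart p *m A) 0 k = if (k < d)%N
    then moment a x k
    else \sum_(i < d) vieta x 0 i * mu_seq (k - d + i)%N.
  rewrite mul_row_col mxE [X in X + _]mxE [X in _ + X]mxE.
  case: ltnP => kd.
    rewrite big1 ?add0r; last by move=> i _; rewrite [hankel _ _]mxE kd mulr0.
    rewrite (bigD1 (Ordinal kd))//= [X in _ * X]mxE eqxx mulr1.
    rewrite moment_Vandermonde big1 ?addr0//.
    move=> j; rewrite -val_eqE/= => jk.
    by rewrite [X in _ * X]mxE eq_sym (negPf jk) mulr0.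
  rewrite [X in _ + X]big1 ?addr0; last first.
    by move=> j _; rewrite [X in _ * X]mxE gtn_eqF ?mulr0// (leq_trans _ kd).
  by apply: eq_bigr => i _; rewrite [hankel _ _]mxE ltnNge kd.
split=> [/prony_varietyP[_ /moments_hankel H]|H].
  apply/rowP => k; rewrite cE mxE; have := H k (ltn_ord k); by case: ltnP.
apply/prony_varietyP; split=> //; apply/moments_hankel => k kq.
have /rowP/(_ (Ordinal (kq : k < q.+1)%N)) := H; rewrite cE mxE/=.
by case: ltnP.
Qed.

End PronyCharts.

Theorem theorem2p1 (R : realType) (d : nat) (hd : (1 <= d)%N)
    (mu : 'rV[R]_(2 * d)) (q : nat) (hq : (q <= 2 * d - 1)%N) :
  is_submanifold (prony_space d) (prony_variety q mu) /\
  is_submanifold (node_space d) (prony_nodes q mu).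
Proof.
have hq' : (q < 2 * d)%N by lia.
split; [exact: is_submanifold_prony_variety|exact: is_submanifold_prony_nodes].
Qed.
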